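(* With all objects as in the context (for an arbitrary admissible group $\mathcal G$ of $d\times d$ diagonal matrices and any number of colors $C\ge t$), $$E\left(\frac{C^t}{C(C-1)\cdots(C-t+1)}\cdot\frac{\mathrm{tr}(\mathcal S)}{d\cdot\mathrm{auto}(H)}\right)=\#H,$$ where $\#H$ is the number of subgraphs of $G$ isomorphic to $H$ and $\mathrm{auto}(H)$ is the number of automorphisms of $H$.
   Context: $H$ is a connected finite simple graph with no leaves, with $t$ vertices and $k$ edges. Orient each edge arbitrarily, obtaining $\vec H$ with vertices $1,\dots,t$ and directed edges $\overrightarrow{a_1a_2},\dots,\overrightarrow{a_{2k-1}a_{2k}}$, $a_i\in\{1,\dots,t\}$. For a vertex $b$ let $\Gamma(b)=\{i:a_i=b\}$, and fix a distinguished index $\iota(b)\in\Gamma(b)$. $G$ is a finite simple undirected graph; $\vec G$ replaces each edge $vw$ by $\overrightarrow{vw}$ and $\overrightarrow{wv}$. $\mathcal G$ is a finite group of $d\times d$ complex diagonal matrices whose elements average to the zero matrix; $I$ is the identity. Hash functions $\mathcal X_1,\dots,\mathcal X_{2k}:V(G)\to\mathcal G$: for non-distinguished $i$, $\mathcal X_i$ is chosen independently and uniformly from a $4k$-wise independent family, each value uniform on $\mathcal G$; for $i=\iota(b)$, $\mathcal X_i(v)=\prod_{j\in\Gamma(b),j\ne i}\mathcal X_j(v)^{-1}$ (equal to $I$ if $\Gamma(b)=\{i\}$). Set $\mathcal M_i(\overrightarrow{vw})=\mathcal X_{2i-1}(v)\mathcal X_{2i}(w)$. A coloring $\mathcal C:V(G)\to\{1,\dots,C\}$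 is chosen uniformly from a $4k$-wise independent family, each value uniform. $\mathcal Z_i^{c_1,c_2}=\sum\mathcal M_i(\overrightarrow{vw})$ over edges $\overrightarrow{vw}$ of $\vec G$ with $\mathcal C(v)=c_1$, $\mathcal C(w)=c_2$; $\mathcal S_{(c_1,\dots,c_t)}=\prod_{i=1}^k\mathcal Z_i^{c_{a_{2i-1}},c_{a_{2i}}}$; $\mathcal S=\sum\mathcal S_{(c_1,\dots,c_t)}$ over $t$-tuples of pairwise distinct colors. $E$ is expectation over the hash functions and coloring. *)

(* Defs.v *)
From HB Require Import structures.
From mathcomp Require Import all_boot all_order all_algebra all_fingroup.
From mathcomp Require Import finmap reals complex.

Set Implicit Arguments.
Unset Strict Implicit.
Unset Printing Implicit Defensive.

Import GRing.Theory.

Local Open Scope ring_scope.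

(** * Finite simple graphs *)

Record simple_graph (V : finType) := SimpleGraph {
  adj :> rel V;
  adj_sym : symmetric adj;
  adj_irr : irreflexive adj }.

Section Graphs.
Variable V : finType.
Implicit Type G : simple_graph V.

Definition edges G : {set {set V}} :=
  [set e | [exists u, exists v, adj G u v && (e == [set u; v])]].

Definition degree G (v : V) : nat := #|[set u | adj G v u]|.

Definition connected_graph G : Prop :=
  (0 < #|V|)%N /\ forall u v, connect (adj G) u v.

Definition no_leaves G : Prop := forall v, degree G v != 1%N.

Definition auto G : nat :=
  #|[set s : {perm V} |
      [forall u, forall v, adj G (s u) (s v) == adj G u v]]|.

(* A subgraph is a pair (vertex set, edge set). *)
Definition is_subgraph G (K : {set V} * {set {set V}}) : bool :=
  (K.2 \subset edges G) && [forall e in K.2, e \subset K.1].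

Definition isomorphic_to (W : finType) (H : simple_graph W)
    (K : {set V} * {set {set V}}) : bool :=
  [exists f : {ffun W -> V},
    [&& injectiveb f, [set f u | u : W] == K.1
      & [forall u, forall v, adj H u v == ([set f u; f v] \in K.2)]]].

Definition num_subgraphs (W : finType) (H : simple_graph W) G : nat :=
  #|[set K | is_subgraph G K && isomorphic_to H K]|.

End Graphs.

(** * Orientations *)

(* [(i, false)] and [(i, true)], for [i < k] counted from 0, stand for the
   1-based positions 2i+1 and 2i+2 of the list a_1, ..., a_2k. *)
Definition half_edge (k : nat) : finType := ('I_k * bool)%type.

(* The k directed edges [a (i, false) -> a (i, true)] orient every edge of [H]
   exactly once; in particular [H] has k edges. *)
Definition orientation (t k : nat) (H : simple_graph 'I_t)
    (a : half_edge k -> 'I_t) : Prop :=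
  let e (i : 'I_k) := [set a (i, false); a (i, true)] in
  injective e /\ [set e i | i : 'I_k] = edges H.

Definition Gamma (t k : nat) (a : half_edge k -> 'I_t) (b : 'I_t) :
    {set half_edge k} := [set j | a j == b].

(** * Uniform choices from finite families *)

Definition expectation (F : fieldType) (Omega : finType) (f : Omega -> F) : F :=
  (\sum_(w : Omega) f w) / #|Omega|%:R.

Definition prob (Omega : finType) (A : pred Omega) : rat :=
  #|A|%:R / #|Omega|%:R.

(* [h] is a family of functions [X -> Y] indexed by [Omega]; the drawn member
   is [h w] with [w] uniform in [Omega].  Its values at any at most [n] distinct
   points are independent, and each of them is uniform on [Y]. *)
Definition kwise_independent_family (n : nat) (Omega X Y : finType)
    (h : Omega -> X -> Y) : Prop :=
  (forall (A : {set X}) (y : X -> Y), (#|A| <= n)%N ->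
     prob [pred w | [forall x in A, h w x == y x]]
       = \prod_(x in A) prob [pred w | h w x == y x])
  /\ (forall (x : X) (y : Y), prob [pred w | h w x == y] = #|Y|%:R^-1).

(** * Matrix groups and the sketch *)

Definition diagonal_group (F : fieldType) (d : nat) (GG : {fset 'M[F]_d}) :
    Prop :=
  [/\ 1%:M \in GG,
      {in GG &, forall g g', g *m g' \in GG},
      {in GG, forall g, g \in unitmx /\ invmx g \in GG}
    & {in GG, forall g, is_diag_mx g}].

Definition mean_zero (F : fieldType) (d : nat) (GG : {fset 'M[F]_d}) : Prop :=
  #|` GG|%:R^-1 *: \sum_(g : GG) val g = 0.

Section Sketch.
Variables (F : fieldType) (d t k C : nat) (V : finType).
Variables (G : simple_graph V) (a : half_edge k -> 'I_t).
Variable iota : 'I_t -> half_edge k.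
Variable GG : {fset 'M[F]_d}.

(* [Y j] is the function drawn for the position [j]; the one drawn for a
   distinguished position is ignored. *)
Definition hash (Y : half_edge k -> V -> GG) (j : half_edge k) (v : V) :
    'M[F]_d :=
  if j == iota (a j)
  then \prod_(l in Gamma a (a j) | l != j) invmx (val (Y l v))
  else val (Y j v).

Variables (Y : half_edge k -> V -> GG) (col : V -> 'I_C).

Definition edge_matrix (i : 'I_k) (v w : V) : 'M[F]_d :=
  hash Y (i, false) v *m hash Y (i, true) w.

(* The sum is over ordered pairs, so each edge of [G] is used in both
   directions. *)
Definition Zsum (i : 'I_k) (c1 c2 : 'I_C) : 'M[F]_d :=
  \sum_(e : V * V | [&& adj G e.1 e.2, col e.1 == c1 & col e.2 == c2])
     edge_matrix i e.1 e.2.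

Definition sketch_at (c : {ffun 'I_t -> 'I_C}) : 'M[F]_d :=
  \prod_(i < k) Zsum i (c (a (i, false))) (c (a (i, true))).

Definition sketch : 'M[F]_d :=
  \sum_(c : {ffun 'I_t -> 'I_C} | injectiveb c) sketch_at c.

End Sketch.

(* The hash seeds [w.1 j] and the coloring seed [w.2] are all independent and
   uniform. *)
Definition seeds (k : nat) (S T : finType) : finType :=
  ({ffun half_edge k -> S} * T)%type.

(* Main.v *)
(** Every matrix in sight is diagonal, so the trace is a sum of scalar sketches,
    one for each diagonal entry [chi].  Expanding the product of sums, a scalar
    sketch is a sum over the placements [p] of the half-edges of [H] in [G].  The
    seeds of distinct half-edges are independent, and the distinguished hash
    functions make the contribution of [j] equal to
    [chi (h (p j)) / chi (h (p (iota (a j))))]: this is [1] when the two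
    vertices agree and has mean zero otherwise.  Hence only the placements induced
    by a homomorphism [f] from [H] to [G] survive, and such an [f] is counted with
    the probability that [col \o f] is injective, which vanishes unless [f] is
    injective.  Finally each copy of [H] in [G] is the image of exactly [auto H]
    injective homomorphisms. *)
Require Import Defs.
From mathcomp Require Import all_boot all_order all_algebra all_fingroup.
From mathcomp Require Import finmap reals complex ring.

Set Implicit Arguments.
Unset Strict Implicit.
Unset Printing Implicit Defensive.

Import GRing.Theory Num.Theory.

Local Open Scope ring_scope.

(** * Injective homomorphisms and copies *)

Lemma set2_inj (T : finType) (x y z w : T) :
  [set x; y] = [set z; w] -> (x = z /\ y = w) \/ (x = w /\ y = z).
Proof.
move=> eq_s.
have: x \in [set z; w] by rewrite -eq_s set21.
have: y \in [set z; w] by rewrite -eq_s set22.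
have: z \in [set x; y] by rewrite eq_s set21.
have: w \in [set x; y] by rewrite eq_s set22.
rewrite !inE => /orP[]/eqP-> /orP[]/eqP-> /orP[]/eqP ? /orP[]/eqP ?; subst; auto.
Qed.

Section Copies.
Variables (W V : finType) (H : simple_graph W) (G : simple_graph V).
Implicit Types (f : {ffun W -> V}) (K : {set V} * {set {set V}}).

Definition is_hom f : bool :=
  [forall u, forall v, adj H u v ==> adj G (f u) (f v)].

(** The condition under the existential in [isomorphic_to], with the witness exposed so that the
    parametrisations of [K] can be counted. *)
Definition is_copy f K : bool :=
  [&& injectiveb f, [set f u | u : W] == K.1
    & [forall u, forall v, adj H u v == ([set f u; f v] \in K.2)]].

Definition copy f : {set V} * {set {set V}} :=
  ([set f u | u : W], [set [set f p.1; f p.2] | p : W * W & adj H p.1 p.2]).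

Lemma mem_edges (u v : V) : ([set u; v] \in edges G) = adj G u v.
Proof.
rewrite inE; apply/existsP/idP => [[x /existsP[y /andP[xy /eqP /set2_inj]]]|uv].
  by case=> -[-> ->] //; rewrite adj_sym.
by exists u; apply/existsP; exists v; rewrite uv eqxx.
Qed.

(** Inside [G], a map parametrises only its own image, so [K] is forced; that image lies in [G]
    exactly when [f] preserves adjacency. *)
Lemma is_copyE f K : is_subgraph G K && is_copy f K =
  (injectiveb f && is_hom f) && (K == copy f).
Proof.
apply/idP/idP.
  case/andP=> /andP[/subsetP sEG /forall_inP sKV] /and3P[inj_f /eqP fK1 /forallP fK2].
  have {}fK2 u v : adj H u v = ([set f u; f v] \in K.2) by apply/eqP/(forallP (fK2 u)).
  rewrite inj_f; apply/andP; split.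
    apply/forallP=> u; apply/forallP=> v; apply/implyP.
    by rewrite fK2 => /sEG; rewrite mem_edges.
  apply/eqP; rewrite /copy fK1 [LHS]surjective_pairing; congr pair.
  apply/setP=> e; apply/idP/imsetP => [eK | [[u v]]]; last by rewrite inE fK2 => ? ->.
  have := sEG e eK; rewrite inE => /existsP[x /existsP[y /andP[xy /eqP def_e]]].
  have /subsetP se := sKV e eK.
  have: x \in K.1 by rewrite se // def_e set21.
  have: y \in K.1 by rewrite se // def_e set22.
  rewrite -fK1 => /imsetP[v _ def_y] /imsetP[u _ def_x].
  by exists (u, v); rewrite /= ?inE /= ?fK2 -?def_x -?def_y -?def_e.
case/andP=> /andP[inj_f hom_f] /eqP->; rewrite /is_copy inj_f eqxx /=.
move/injectiveP: (inj_f) => f_inj.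
apply/andP; split; [apply/andP; split|].
- apply/subsetP=> e /imsetP[[u v]]; rewrite inE /= => uv ->.
  by rewrite mem_edges; move/forallP/(_ u)/forallP/(_ v)/implyP: hom_f; apply.
- apply/forall_inP=> e /imsetP[[u v] _ ->] /=.
  by apply/subsetP=> x; rewrite !inE => /orP[] /eqP->; apply: imset_f.
- apply/forallP=> u; apply/forallP=> v; apply/eqP; apply/idP/imsetP => [uv|[[u' v']]].
    by exists (u, v); rewrite ?inE.
  by rewrite inE /= => uv' /set2_inj[] [/f_inj-> /f_inj->] //; rewrite adj_sym.
Qed.

(* Two parametrisations of [K] differ by an automorphism of [H]. *)
Lemma card_copies f0 K : is_copy f0 K -> #|[set f | is_copy f K]| = auto H.
Proof.
case/and3P=> /injectiveP inj_f0 /eqP f0K1 /forallP f0K2.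
have {}f0K2 u v : adj H u v = ([set f0 u; f0 v] \in K.2) by apply/eqP/(forallP (f0K2 u)).
pose F (s : {perm W}) := [ffun u => f0 (s u)].
have inj_F : injective F.
  by move=> s s' /ffunP eqF; apply/permP=> u; apply: inj_f0; have := eqF u; rewrite !ffunE.
rewrite /auto -(card_imset _ inj_F); apply: eq_card => f; rewrite !inE.
apply/idP/imsetP => [|[s]].
  case/and3P=> /injectiveP inj_f /eqP fK1 /forallP fK2.
  have {}fK2 u v : adj H u v = ([set f u; f v] \in K.2) by apply/eqP/(forallP (fK2 u)).
  have f_f0 u : {v | f u = f0 v}.
    apply: sig_eqW.
    have: f u \in [set f0 v | v : W] by rewrite f0K1 -fK1 imset_f.
    by case/imsetP=> v _ ->; exists v.
  have [s fs] : {s : W -> W | forall u, f u = f0 (s u)}.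
    by exists (fun u => sval (f_f0 u)) => u; apply: (svalP (f_f0 u)).
  have inj_s : injective s by move=> u v eq_s; apply: inj_f; rewrite !fs eq_s.
  exists (perm inj_s); last by apply/ffunP=> u; rewrite ffunE permE fs.
  rewrite inE; apply/forallP=> u; apply/forallP=> v.
  by rewrite !permE f0K2 fK2 !fs.
rewrite inE => /forallP s_aut ->; apply/and3P; split.
- by apply/injectiveP=> u v; rewrite !ffunE => /inj_f0/perm_inj.
- rewrite -f0K1; apply/eqP; apply/setP=> x; apply/imsetP/imsetP.
    by case=> u _ ->; exists (s u); rewrite ?ffunE.
  by case=> u _ ->; exists ((s^-1)%g u); rewrite ?ffunE ?permKV.
- apply/forallP=> u; apply/forallP=> v; rewrite !ffunE -f0K2 eq_sym.
  exact: (forallP (s_aut u)).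
Qed.

(** Double counting of pairs of a map and a subgraph: an injective homomorphism has exactly one
    image, and a copy of [H] has [auto H] parametrisations. *)
Lemma card_inj_homs :
  #|[set f : {ffun W -> V} | injectiveb f && is_hom f]| = (num_subgraphs H G * auto H)%N.
Proof.
transitivity (\sum_(f : {ffun W -> V}) \sum_(K : {set V} * {set {set V}}) (is_subgraph G K && is_copy f K : nat))%N.
  rewrite -sum1_card big_mkcond /=; apply: eq_bigr => f _; rewrite inE.
  under eq_bigr => K _ do rewrite is_copyE.
  case: ifP => _; last by rewrite big1.
  by rewrite (bigD1 (copy f)) //= eqxx big1 // => K /negbTE->.
rewrite exchange_big -sum_nat_const [RHS]big_mkcond /=; apply: eq_bigr => K _.
rewrite inE; case: (is_subgraph G K) => /=; last by rewrite big1.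
have <- : #|[set f | is_copy f K]| = (\sum_(f : {ffun W -> V}) (is_copy f K : nat))%N.
  by rewrite -sum1_card big_mkcond; apply: eq_bigr => f _; rewrite inE; case: is_copy.
case: ifP => [/existsP[f] | /negbT/existsPn no_f]; first exact: card_copies.
by apply: eq_card0 => f; rewrite inE; apply/negbTE/no_f.
Qed.

End Copies.

Lemma auto_gt0 (W : finType) (H : simple_graph W) : (0 < auto H)%N.
Proof.
apply/card_gt0P; exists 1%g; rewrite inE; apply/forallP=> u; apply/forallP=> v.
by rewrite !perm1.
Qed.

(** Adjacency in [G] is symmetric, so testing each edge of [H] in its chosen direction suffices. *)
Lemma orientation_homE (V : finType) (t k : nat) (H : simple_graph 'I_t)
    (G : simple_graph V) (a : half_edge k -> 'I_t) (f : {ffun 'I_t -> V}) :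
  orientation H a ->
  [forall i, adj G (f (a (i, false))) (f (a (i, true)))] = is_hom H G f.
Proof.
case=> _ im_e.
apply/forallP/forallP => [hom_f u | hom_f i].
  apply/forallP=> v; apply/implyP; rewrite -mem_edges -im_e => /imsetP[i _ /set2_inj].
  by case=> -[-> ->]; rewrite // adj_sym.
apply: (implyP (forallP (hom_f _) _)); rewrite -mem_edges -im_e.
by apply: imset_f.
Qed.

(** * Expectations *)

Section Expectation.
Variable F : numFieldType.

Lemma eq_expectation (S : finType) (f g : S -> F) :
  f =1 g -> expectation f = expectation g.
Proof. by move=> fg; congr (_ / _); apply: eq_bigr. Qed.

Lemma expectation_sum (S I : finType) (P : pred I) (f : I -> S -> F) :
  expectation (fun w => \sum_(i | P i) f i w) = \sum_(i | P i) expectation (f i).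
Proof. by rewrite /expectation exchange_big mulr_suml. Qed.

Lemma expectationZ (S : finType) (c : F) (f : S -> F) :
  expectation (fun w => c * f w) = c * expectation f.
Proof. by rewrite /expectation -mulr_sumr mulrA. Qed.

Lemma expectation_cst (S : finType) (c : F) :
  (0 < #|S|)%N -> expectation (fun _ : S => c) = c.
Proof.
by move=> S_gt0; rewrite /expectation sumr_const -[c *+ _]mulr_natr mulfK // pnatr_eq0 -lt0n.
Qed.

Lemma expectation_pair (S T : finType) (f : S -> F) (g : T -> F) :
  expectation (fun w : S * T => f w.1 * g w.2) = expectation f * expectation g.
Proof.
rewrite /expectation card_prod natrM invfM mulrACA; congr (_ * _).
rewrite mulr_suml -(pair_big predT predT (fun x y => f x * g y)) /=.
by apply: eq_bigr => x _; rewrite mulr_sumr.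
Qed.

Lemma expectation_ffun (I S : finType) (f : I -> S -> F) :
  expectation (fun w : {ffun I -> S} => \prod_i f i (w i)) =
  \prod_i expectation (f i).
Proof.
rewrite /expectation big_split /= prodr_const card_ffun natrX exprVn.
by rewrite bigA_distr_bigA.
Qed.

(** For the empty set of points, independence equates [prob] with the empty product 1, whereas on an
    empty seed type division by zero gives 0. *)
Lemma kwise_card_gt0 (n : nat) (S X Y : finType) (h : S -> X -> Y) (y : X -> Y) :
  kwise_independent_family n h -> (0 < #|S|)%N.
Proof.
case=> /(_ set0 y); rewrite cards0 big_set0 => /(_ isT) + _; rewrite lt0n.
apply: contra_eq_neq; rewrite /prob => ->; rewrite invr0 mulr0 eq_sym.
exact: oner_neq0.
Qed.

(** The values at no more than [n] distinct points form a uniform vector: the fibres of seeds over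
    the possible vectors all have the same size. *)
Lemma kwise_expectation (n : nat) (S I X Y : finType) (h : S -> X -> Y)
    (x : I -> X) (phi : {ffun I -> Y} -> F) :
  (0 < #|S|)%N -> kwise_independent_family n h -> injective x -> (#|I| <= n)%N ->
  expectation (fun w => phi [ffun i => h w (x i)]) = expectation phi.
Proof.
move=> S_gt0 h_indep inj_x I_le_n.
have fiber y : #|[set w | [ffun i => h w (x i)] == y]|%:R =
    #|S|%:R * #|Y|%:R^-1 ^+ #|I| :> F.
  (* An empty [I] offers no default for [z] below; both sides are then the number of seeds. *)
  have [x0 | I0] := pickP (@predT I); last first.
    rewrite (eq_card0 I0) expr0 mulr1 -cardsT; congr (_%:R); apply: eq_card => w.
    by rewrite !inE; apply/eqP/ffunP=> i; have := I0 i.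
  pose A := [set x i | i : I].
  (* Independence is stated for functions on all of [X], so [y] is transported along [x], with the
     arbitrary value [y x0] off the image. *)
  pose z v := if [pick i | x i == v] is Some i then y i else y x0.
  have zx i : z (x i) = y i.
    rewrite /z; case: pickP => [i' /eqP /inj_x-> //|/(_ i)]; by rewrite eqxx.
  have cA : #|A| = #|I| by rewrite card_imset.
  case: h_indep => /(_ A z); rewrite cA => /(_ I_le_n) indep unif.
  move: indep; under eq_bigr => v _ do rewrite unif.
  (* [prob] is rational, hence the passage to [F] through [ratr]. *)
  rewrite prodr_const cA => /(congr1 (@ratr F)).
  rewrite /prob rmorphM rmorphXn !fmorphV /= !ratr_nat => <- _.
  rewrite mulrC divfK ?pnatr_eq0 -?lt0n //; congr (_%:R); apply: eq_card => w.
  rewrite !inE; apply/eqP/forall_inP=> [eq_y v /imsetP[i _ ->] | hz].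
    by rewrite zx -eq_y ffunE.
  by apply/ffunP=> i; rewrite ffunE -zx; apply/eqP/hz/imset_f.
rewrite /expectation (partition_big (fun w => [ffun i => h w (x i)]) predT) //=.
have {}fiber y : \sum_(w | [ffun i => h w (x i)] == y) phi [ffun i => h w (x i)] =
    phi y * (#|S|%:R * #|Y|%:R^-1 ^+ #|I|).
  transitivity (\sum_(w in [set w | [ffun i => h w (x i)] == y]) phi y).
    by apply: eq_big => [w | w /eqP-> //]; rewrite inE.
  by rewrite sumr_const -[phi y *+ _]mulr_natr fiber.
under eq_bigr => y _ do rewrite fiber.
rewrite -mulr_suml card_ffun natrX exprVn -mulrA; congr (_ * _).
by rewrite mulrAC mulfV ?mul1r // pnatr_eq0 -lt0n.
Qed.

Lemma prodr_bool (I : finType) (b : pred I) :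
  \prod_i (b i)%:R = [forall i, b i]%:R :> F.
Proof.
have [/forallP all_b | /forallPn[i /negbTE bi]] := boolP [forall i, b i].
  by rewrite big1 // => i _; rewrite all_b.
by rewrite (bigD1 i) //= bi mul0r.
Qed.

(** At distinct points the values are a uniform tuple, and the injective tuples number
    [#|Y| ^_ #|I|]; a repeated point repeats its value for every seed. *)
Lemma expectation_injective (n : nat) (S I X Y : finType) (h : S -> X -> Y)
    (x : {ffun I -> X}) :
  (0 < #|S|)%N -> kwise_independent_family n h -> (#|I| <= n)%N ->
  expectation (fun w => (injectiveb [ffun i => h w (x i)])%:R) =
  (injectiveb x)%:R * ((#|Y| ^_ #|I|)%:R / (#|Y| ^ #|I|)%:R) :> F.
Proof.
move=> S_gt0 h_indep I_le_n; have [/injectiveP inj_x | not_inj] := boolP (injectiveb x).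
  rewrite mul1r (kwise_expectation (fun y => (injectiveb y)%:R) S_gt0 h_indep inj_x) //.
  rewrite /expectation -natr_sum card_ffun; congr (_%:R / _).
  rewrite -card_inj_ffuns -sum1_card [RHS]big_mkcond /=; apply: eq_bigr => y _.
  by rewrite inE; case: injectiveb.
rewrite mul0r /expectation big1 ?mul0r // => w _; case: injectiveP => // inj_hx.
by case/injectiveP: not_inj => i j eq_x; apply: inj_hx; rewrite !ffunE eq_x.
Qed.

End Expectation.

(** * The scalar sketch *)

Section ScalarSketch.
Variables (F : numFieldType) (n t k C : nat) (H : simple_graph 'I_t).
Variables (V Y S T : finType) (G : simple_graph V) (a : half_edge k -> 'I_t).
Variables (iota : 'I_t -> half_edge k) (chi : Y -> F).
Variables (h : S -> V -> Y) (col : T -> V -> 'I_C).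
Hypothesis a_orientation : orientation H a.
Hypothesis iotaK : cancel iota a.
Hypothesis chi_neq0 : forall y, chi y != 0.
Hypothesis sum_chi : \sum_y chi y = 0.
Hypotheses (S_gt0 : (0 < #|S|)%N) (T_gt0 : (0 < #|T|)%N).
Hypotheses (n_ge2 : (2 <= n)%N) (t_le_n : (t <= n)%N).
Hypothesis h_family : kwise_independent_family n h.
Hypothesis col_family : kwise_independent_family n col.

(** A diagonal entry of [hash], once [chi] is taken to read off that entry. *)
Definition scalar_hash (X : half_edge k -> V -> Y) (j : half_edge k) (v : V) : F :=
  if j == iota (a j)
  then \prod_(l in Gamma a (a j) | l != j) (chi (X l v))^-1
  else chi (X j v).

Definition scalar_sketch (X : half_edge k -> V -> Y) (c0 : V -> 'I_C) : F :=
  \sum_(c : {ffun 'I_t -> 'I_C} | injectiveb c) \prod_(i < k)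
    \sum_(e : V * V | [&& adj G e.1 e.2, c0 e.1 == c (a (i, false))
                         & c0 e.2 == c (a (i, true))])
      scalar_hash X (i, false) e.1 * scalar_hash X (i, true) e.2.

(** At distinct vertices the two values are independent, so the expectation factors, and the mean of
    [chi] is zero. *)
Lemma expectation_ratio (u v : V) :
  expectation (fun s => chi (h s u) / chi (h s v)) = (u == v)%:R.
Proof.
have [-> | neq_uv] := eqVneq u v.
  rewrite -[RHS](expectation_cst _ S_gt0); apply: eq_expectation => s.
  by rewrite mulfV.
pose x (b : bool) := if b then u else v.
have inj_x : injective x.
  by case=> -[] //= /eqP; rewrite ?(negbTE neq_uv) // eq_sym (negbTE neq_uv).
pose psi (b : bool) y := if b then chi y else (chi y)^-1.
transitivity (expectation (fun y : {ffun bool -> Y} => \prod_b psi b (y b))).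
  rewrite -(kwise_expectation _ S_gt0 h_family inj_x) ?card_bool //.
  by apply: eq_expectation => s; rewrite big_bool !ffunE.
by rewrite expectation_ffun big_bool /= {1}/expectation sum_chi !mul0r.
Qed.

(** Regrouping by seed: a non-distinguished [l] occurs in its own factor and, inverted, in that of
    [iota (a l)]. Each new factor involves a single seed. *)
Lemma prod_scalar_hash (X : half_edge k -> V -> Y) (p : half_edge k -> V) :
  \prod_j scalar_hash X j (p j) =
  \prod_j (if j == iota (a j) then 1
           else chi (X j (p j)) / chi (X j (p (iota (a j))))).
Proof.
rewrite (bigID (fun j => j == iota (a j))) /= mulrC.
under eq_bigr => j /negbTE jF do rewrite /scalar_hash jF.
under [X in _ * X]eq_bigr => j jT do rewrite /scalar_hash jT.
rewrite (exchange_big_dep (fun l => l != iota (a l))) /=; last first.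
  by move=> j l /eqP def_j; rewrite inE => /andP[/eqP->]; rewrite -def_j.
rewrite -big_split /= big_mkcond /=; apply: eq_bigr => l _.
(* Among the distinguished [j], only [iota (a l)] has [l] in its product. *)
case: eqP => //= /eqP l_neq; rewrite (big_pred1 (iota (a l))) // => j.
rewrite /= inE eq_sym; have [-> | neq_j] := eqVneq j (iota (a l)).
  by rewrite iotaK !eqxx l_neq.
apply/negbTE; apply: contra neq_j => /andP[/eqP def_j /andP[/eqP-> _]].
by rewrite def_j.
Qed.

(** The regrouped factors depend on independent seeds, so the expectation is a product of
    indicators. *)
Lemma expectation_scalar_hash (p : half_edge k -> V) :
  expectation (fun X : {ffun half_edge k -> S} =>
    \prod_j scalar_hash (fun j => h (X j)) j (p j)) =
  [forall j, p j == p (iota (a j))]%:R.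
Proof.
pose psi j s : F :=
  if j == iota (a j) then 1 else chi (h s (p j)) / chi (h s (p (iota (a j)))).
transitivity (expectation (fun X : {ffun half_edge k -> S} => \prod_j psi j (X j))).
  by apply: eq_expectation => X; rewrite prod_scalar_hash.
rewrite expectation_ffun -prodr_bool; apply: eq_bigr => j _.
rewrite /psi; case: (j =P iota (a j)) => [<- | _]; last exact: expectation_ratio.
by rewrite eqxx expectation_cst.
Qed.

(** * Expansion of the sketch over placements *)

Definition placed (phi : {ffun 'I_k -> V * V}) (j : half_edge k) : V :=
  if j.2 then (phi j.1).2 else (phi j.1).1.

Definition placement (f : {ffun 'I_t -> V}) : {ffun 'I_k -> V * V} :=
  [ffun i => (f (a (i, false)), f (a (i, true)))].

Lemma placedE (f : {ffun 'I_t -> V}) j : placed (placement f) j = f (a j).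
Proof. by rewrite /placed ffunE; case: j => i []. Qed.

(** Distribute the product over the sums. The color condition becomes an indicator factor, so the
    range of [phi] is free of the coloring and expectations can pass inside. *)
Lemma scalar_sketchE (X : half_edge k -> V -> Y) (c0 : V -> 'I_C) :
  scalar_sketch X c0 =
  \sum_(phi : {ffun 'I_k -> V * V} | [forall i, adj G (phi i).1 (phi i).2])
    \sum_(c : {ffun 'I_t -> 'I_C} | injectiveb c)
      (\prod_j scalar_hash X j (placed phi j)) *
      [forall j, c0 (placed phi j) == c (a j)]%:R.
Proof.
rewrite exchange_big /=; apply: eq_bigr => c _.
rewrite bigA_distr_big_dep /= big_mkcond [RHS]big_mkcond /=.
apply: eq_bigr => phi _.
have ->: (\prod_j scalar_hash X j (placed phi j)) =
  \prod_(i < k) (scalar_hash X (i, false) (phi i).1 * scalar_hash X (i, true) (phi i).2).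
  transitivity (\prod_i \prod_b scalar_hash X (i, b) (placed phi (i, b))).
    by rewrite pair_bigA; apply: eq_bigr => -[].
  by apply: eq_bigr => i _; rewrite big_bool mulrC.
rewrite mulr_natr -mulrb; case: forallP => adj_phi; last first.
  case: familyP => // fam; case: adj_phi => i.
  by have := fam i; rewrite unfold_in => /and3P[].
congr (_ *+ nat_of_bool _); apply/familyP/forallP => [fam [i b] | col_c i].
  by have := fam i; rewrite unfold_in /placed => /and3P[_ ? ?]; case: b.
by rewrite unfold_in adj_phi (col_c (i, false)) (col_c (i, true)).
Qed.

Lemma expectation_scalar_sketch :
  expectation (fun w : seeds k S T =>
    scalar_sketch (fun j => h (w.1 j)) (col w.2)) =
  #|[set f : {ffun 'I_t -> V} | injectiveb f && is_hom H G f]|%:R *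
  ((C ^_ t)%:R / (C ^ t)%:R).
Proof.
(* In a consistent placement all half-edges at [b] sit on one vertex; the distinguished one serves
   as representative. *)
pose sigma (phi : {ffun 'I_k -> V * V}) := [ffun b => placed phi (iota b)].
transitivity (\sum_(phi : {ffun 'I_k -> V * V} |
      [forall i, adj G (phi i).1 (phi i).2] &&
      [forall j, placed phi j == placed phi (iota (a j))])
    (injectiveb (sigma phi))%:R * ((C ^_ t)%:R / (C ^ t)%:R) : F).
  rewrite (eq_expectation (fun w => scalar_sketchE _ _)) expectation_sum big_mkcondr /=.
  apply: eq_bigr => phi _; rewrite expectation_sum.
  under eq_bigr => c _.
    rewrite (expectation_pair
      (fun X : {ffun half_edge k -> S} =>
         \prod_j scalar_hash (fun j => h (X j)) j (placed phi j))
      (fun w => [forall j, col w (placed phi j) == c (a j)]%:R)).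
    rewrite expectation_scalar_hash; over.
  (* Inconsistent placements have hash expectation zero. *)
  rewrite -mulr_sumr; case: forallP => [phi_a | _]; last by rewrite mul0r.
  have := expectation_injective F (sigma phi) T_gt0 col_family.
  rewrite !card_ord mul1r => <- //; rewrite -expectation_sum.
  apply: eq_expectation => w; set y := finfun _.
  (* Only [c = y], the coloring pulled back along [sigma phi], matches at every half-edge; the sum
     over [c] reduces to the indicator that [y] is injective. *)
  rewrite big_mkcond (bigD1 y) //= big1 ?addr0 => [|c /negP c_neq].
    case: injectiveb => //; case: forallP => // -[] j.
    by rewrite !ffunE (eqP (phi_a j)).
  case: injectiveb => //; case: forallP => // col_c; case: c_neq.
  apply/eqP/ffunP=> b; rewrite !ffunE (eqP (col_c _)) iotaK //.
rewrite -mulr_suml; congr (_ * _).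
(* Consistent placements correspond to vertex maps, with [placement] and [sigma] as mutually inverse
   bijections. *)
rewrite (reindex_onto placement sigma) /=; last first.
  move=> phi /andP[_ /forallP phi_a]; apply/ffunP=> i.
  by rewrite !ffunE -!(eqP (phi_a _)) /placed /= -surjective_pairing.
have sigmaK f : sigma (placement f) = f.
  by apply/ffunP=> b; rewrite ffunE placedE iotaK.
rewrite -sum1_card natr_sum big_mkcond [RHS]big_mkcond /=; apply: eq_bigr => f _.
rewrite sigmaK eqxx inE -(orientation_homE G f a_orientation).
have ->: [forall j, placed (placement f) j == placed (placement f) (iota (a j))].
  by apply/forallP=> j; rewrite !placedE iotaK.
have ->: [forall i, adj G (placement f i).1 (placement f i).2] =
    [forall i, adj G (f (a (i, false))) (f (a (i, true)))].
  by apply: eq_forallb => i; rewrite ffunE.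
by rewrite !andbT andbC; case: [forall i, _]; case: injectiveb.
Qed.

End ScalarSketch.

(** * Diagonal matrices *)

Section DiagonalEntry.
Variables (F : numFieldType) (d : nat) (x : 'I_d).

(** Diagonality travels with the entry because it makes the entry multiplicative; the relational
    form suits [big_ind2]. *)
Definition diag_entry (A : 'M[F]_d) (r : F) : Prop := is_diag_mx A /\ A x x = r.

Lemma diag_entry_sum (I : finType) (P : pred I) (A : I -> 'M[F]_d) (r : I -> F) :
  (forall i, P i -> diag_entry (A i) (r i)) ->
  diag_entry (\sum_(i | P i) A i) (\sum_(i | P i) r i).
Proof.
apply: (big_ind2 diag_entry); first by split; rewrite ?mxE // mx0_is_diag.
move=> A1 r1 A2 r2 [/is_diag_mxP d1 <-] [/is_diag_mxP d2 <-]; split; rewrite ?mxE //.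
by apply/is_diag_mxP=> i j neq_ij; rewrite mxE d1 ?d2 ?addr0.
Qed.

Lemma diag_entry_mul (A1 A2 : 'M[F]_d) (r1 r2 : F) :
  diag_entry A1 r1 -> diag_entry A2 r2 -> diag_entry (A1 *m A2) (r1 * r2).
Proof.
case=> /is_diag_mxP d1 <- [/is_diag_mxP d2 <-].
have mulE i j : (A1 *m A2) i j = A1 i i * A2 i j.
  rewrite mxE (bigD1 i) //= big1 ?addr0 // => l neq_l.
  by rewrite d1 ?mul0r // eq_sym.
by split=> //; apply/is_diag_mxP=> i j neq_ij; rewrite mulE d2 ?mulr0.
Qed.

Lemma diag_entry_prod (I : finType) (P : pred I) (A : I -> 'M[F]_d) (r : I -> F) :
  (forall i, P i -> diag_entry (A i) (r i)) ->
  diag_entry (\prod_(i | P i) A i) (\prod_(i | P i) r i).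
Proof.
apply: (big_ind2 diag_entry); last by move=> A1 r1 A2 r2; apply: diag_entry_mul.
by split; rewrite ?mxE ?eqxx // scalar_mx_is_diag.
Qed.

(** Both [g] and its inverse are diagonal, so their entries at [x] multiply to 1. *)
Lemma diag_entry_inv (GG : {fset 'M[F]_d}) (g : GG) :
  diagonal_group GG -> val g x x != 0 /\ diag_entry (invmx (val g)) (val g x x)^-1.
Proof.
case=> _ _ /(_ _ (valP g))[g_unit gV] diagG.
have [_] := diag_entry_mul (conj (diagG _ (valP g)) erefl) (conj (diagG _ gV) erefl).
rewrite mulmxV // !mxE eqxx => /esym gK.
have g_neq0 : val g x x != 0.
  by apply: contra_eq_neq gK => ->; rewrite mul0r eq_sym oner_eq0.
by do 2?split; rewrite ?diagG //; apply: (mulfI g_neq0); rewrite mulfV.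
Qed.

(** The sketch is built from members of [GG] by sums, products and inverses, all of which commute
    with taking a diagonal entry. *)
Lemma sketch_entry (t k C : nat) (V : finType) (G : simple_graph V)
    (a : half_edge k -> 'I_t) (iota : 'I_t -> half_edge k) (GG : {fset 'M[F]_d})
    (X : half_edge k -> V -> GG) (c0 : V -> 'I_C) :
  diagonal_group GG ->
  diag_entry (sketch G a iota X c0)
    (scalar_sketch G a iota (fun g : GG => val g x x) X c0).
Proof.
move=> GG_group.
have hashE j v : diag_entry (hash a iota X j v)
    (scalar_hash a iota (fun g : GG => val g x x) X j v).
  rewrite /hash /scalar_hash; case: ifP => _.
    by apply: diag_entry_prod => l _; have [] := diag_entry_inv (X l v) GG_group.
  by case: GG_group => _ _ _ diagG; split=> //; apply: diagG (valP (X j v)).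
apply: diag_entry_sum => c _; apply: diag_entry_prod => i _.
by apply: diag_entry_sum => e _; apply: diag_entry_mul.
Qed.

End DiagonalEntry.

(** * Averaging the trace and normalising *)

Theorem theorem2p4 (R : realType) (t k d C : nat)
  (H : simple_graph 'I_t) (a : half_edge k -> 'I_t)
  (iota : 'I_t -> half_edge k)
  (V : finType) (G : simple_graph V)
  (GG : {fset 'M[complex R]_d})
  (S T : finType) (h : S -> V -> GG) (col : T -> V -> 'I_C)
  (H_connected : connected_graph H)
  (H_no_leaves : no_leaves H)
  (a_orientation : orientation H a)
  (iota_in : forall b : 'I_t, iota b \in Gamma a b)
  (d_gt0 : (0 < d)%N)
  (GG_group : diagonal_group GG)
  (GG_mean : mean_zero GG)
  (h_family : kwise_independent_family (4 * k) h)
  (col_family : kwise_independent_family (4 * k) col)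
  (C_ge_t : (t <= C)%N) :
  expectation (fun w : seeds k S T =>
      (C ^ t)%:R / (C ^_ t)%:R
      * (\tr (sketch G a iota (fun j => h (w.1 j)) (col w.2))
         / (d%:R * (auto H)%:R)))
  = (num_subgraphs H G)%:R :> complex R.
Proof.
have iotaK : cancel iota a by move=> b; have := iota_in b; rewrite inE => /eqP.
have t_gt0 : (0 < t)%N by case: H_connected; rewrite card_ord.
(* The distinguished half-edge at the first vertex witnesses an edge of [H]. *)
have k_gt0 : (0 < k)%N by case: (iota (Ordinal t_gt0)) => -[i /(leq_ltn_trans (leq0n i))].
have C_gt0 : (0 < C)%N := leq_trans t_gt0 C_ge_t.
(* Distinguished half-edges of different vertices differ, so [t] is at most [2 * k], and the
   independence of the coloring covers the images of all [t] vertices. *)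
have t_le_4k : (t <= 4 * k)%N.
  have := leq_card iota (can_inj iotaK); rewrite card_prod !card_ord card_bool => t_le.
  by rewrite (leq_trans t_le) // mulnC leq_mul2r orbT.
have T_gt0 := kwise_card_gt0 (fun=> Ordinal C_gt0) col_family.
have GG1 : 1%:M \in GG by case: GG_group.
have S_gt0 := kwise_card_gt0 (fun=> [` GG1]%fset) h_family.
(* [GG] contains the identity, so the inverse of its cardinality is nonzero and cancels from the
   mean. *)
have sum_chi x : \sum_(g : GG) val g x x = 0.
  move/matrixP/(_ x x): GG_mean; rewrite !mxE summxE => /eqP.
  rewrite mulf_eq0 invr_eq0 pnatr_eq0 cardfs_eq0.
  by case/orP=> /eqP // GG0; rewrite GG0 in_fset0 in GG1.
pose N := #|[set f : {ffun 'I_t -> V} | injectiveb f && is_hom H G f]|.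
have E_tr : expectation (fun w : seeds k S T =>
    \tr (sketch G a iota (fun j => h (w.1 j)) (col w.2))) =
    d%:R * (N%:R * ((C ^_ t)%:R / (C ^ t)%:R)) :> complex R.
  (* The trace adds [d] diagonal entries, all with the same expectation. *)
  rewrite expectation_sum mulr_natl -[d in RHS]card_ord -sumr_const.
  apply: eq_bigr => x _.
  rewrite (eq_expectation (fun w => (sketch_entry x G a iota _ _ GG_group).2)).
  apply: (expectation_scalar_sketch G a_orientation iotaK _ (sum_chi x) S_gt0 T_gt0
            _ t_le_4k h_family col_family) => [g|].
    by have [] := diag_entry_inv x g GG_group.
  by rewrite (leq_trans _ (leq_pmulr 4 k_gt0)).
have d_neq0 : d%:R != 0 :> complex R by rewrite pnatr_eq0 -lt0n.
have auto_neq0 : (auto H)%:R != 0 :> complex R by rewrite pnatr_eq0 -lt0n auto_gt0.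
have C_neq0 : (C ^ t)%:R != 0 :> complex R by rewrite pnatr_eq0 -lt0n expn_gt0 C_gt0.
have Ct_neq0 : (C ^_ t)%:R != 0 :> complex R by rewrite pnatr_eq0 -lt0n ffact_gt0.
rewrite expectationZ.
under eq_expectation => w do rewrite mulrC.
rewrite expectationZ E_tr /N card_inj_homs natrM.
by field; rewrite C_neq0 Ct_neq0 auto_neq0 d_neq0.
Qed.
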